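(* Let $(X,T)$ be a topological dynamical system and let $\mathcal{E}\colon\mathcal{M}(X)\to\mathbb{R}$ be an energy. Then the following quantities all coincide with $P(T,\mathcal{E})$: (i) $Q(T,\mathcal{E})$; (ii) $\lim_{\varepsilon\to0}\sup\{P_i(T,\mathcal{E};\mathcal{U}):\mathcal{U}\in\mathcal{C}_X^o,\ \mathrm{diam}(\mathcal{U})\le\varepsilon\}$, for every $i\in\{1,2,3,4\}$; (iii) $\lim_{k\to\infty}P_i(T,\mathcal{E};\mathcal{U}_k)$, for every sequence $\{\mathcal{U}_k\}\subset\mathcal{C}_X^o$ with $\mathrm{diam}(\mathcal{U}_k)\to0$ and every $i\in\{1,2,3,4\}$; (iv) $\sup_{\mathcal{U}\in\mathcal{C}_X^o}P_i(T,\mathcal{E};\mathcal{U})$, for every $i\in\{1,2,4\}$.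
   Context: A topological dynamical system (TDS) is a pair $(X,T)$ with $X$ a compact metric space (metric $d$) and $T:X\to X$ a continuous surjection. $\mathcal{M}(X)$ is the set of Borel probability measures on $X$ with the weak-star topology. An energy is a weak-star continuous function $\mathcal{E}\colon\mathcal{M}(X)\to\mathbb{R}$. For $x\in X$, $n\ge1$, $\triangle_x^n=\frac1n\sum_{i=0}^{n-1}\delta_{T^ix}$. Let $B_n(x,\varepsilon)=\{y\in X:d(T^ix,T^iy)<\varepsilon,\ 0\le i\le n-1\}$. A set $E\subset X$ is $(n,\varepsilon)$-separated if $y\notin B_n(x,\varepsilon)$ for all distinct $x,y\in E$; a set $F\subset X$ is $(n,\varepsilon)$-spanning if for every $x\in X$ there is $y\in F$ with $y\in B_n(x,\varepsilon)$. Let $P_n(T,\mathcal{E},\varepsilon)$ be the supremum of $\sum_{x\in E}e^{n\mathcal{E}(\triangle_x^n)}$ over $(n,\varepsilon)$-separated sets $E$ of $X$, and $Q_n(T,\mathcal{E},\varepsilon)$ the infimum of $\sum_{x\in F}e^{n\mathcal{E}(\triangle_x^n)}$ over $(n,\varepsilon)$-spanning sets $F$ of $X$. Define $$P(T,\mathcal{E})=\lim_{\varepsilon\to0}\limsup_{n\to\infty}\tfrac1n\log P_n(T,\mathcal{E},\varepsilon),\qquad Q(T,\mathcal{E})=\lim_{\varepsilon\to0}\limsup_{n\to\infty}\tfrac1n\log Q_n(T,\mathcal{E},\varepsilon).$$ A cover of $X$ is a finite collection of Borel subsets with union $X$; $\mathcal{C}_X$ and $\mathcal{C}_X^o$ denote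 the sets of covers and of open covers (covers consisting of open sets). $\mathcal{V}\succeq\mathcal{W}$ means each element of $\mathcal{V}$ is contained in some element of $\mathcal{W}$. $\mathcal{U}\vee\mathcal{V}=\{U\cap V: U\in\mathcal{U},V\in\mathcal{V}\}$, $\mathcal{U}_0^{n-1}=\bigvee_{i=0}^{n-1}T^{-i}\mathcal{U}$, and $\mathrm{diam}(\mathcal{U})$ is the maximum of the diameters of the elements of $\mathcal{U}$. For $\mathcal{U}\in\mathcal{C}_X^o$ and $n\ge1$ let $$p_n^1(T,\mathcal{E};\mathcal{U})=\inf\Big\{\sum_{V\in\mathcal{V}}\sup_{x\in V}e^{n\mathcal{E}(\triangle_x^n)}:\mathcal{V}\in\mathcal{C}_X,\ \mathcal{V}\succeq\mathcal{U}_0^{n-1}\Big\},$$ $$p_n^2(T,\mathcal{E};\mathcal{U})=\inf\Big\{\sum_{V\in\mathcal{V}}\inf_{x\in V}e^{n\mathcal{E}(\triangle_x^n)}:\mathcal{V}\in\mathcal{C}_X,\ \mathcal{V}\succeq\mathcal{U}_0^{n-1}\Big\},$$ $$p_n^3(T,\mathcal{E};\mathcal{U})=\inf\Big\{\sum_{B\in\beta}\sup_{x\in B}e^{n\mathcal{E}(\triangle_x^n)}:\beta\text{ a finite subcover of }\mathcal{U}_0^{n-1}\Big\},$$ $$p_n^4(T,\mathcal{E};\mathcal{U})=\inf\Big\{\sum_{B\in\beta}\inf_{x\in B}e^{n\mathcal{E}(\triangle_x^n)}:\beta\text{ a finite subcover of }\mathcal{U}_0^{n-1}\Big\},$$ and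 $P_i(T,\mathcal{E};\mathcal{U})=\limsup_{n\to\infty}\frac1n\log p_n^i(T,\mathcal{E};\mathcal{U})$ for $i=1,2,3,4$. *)

(* Defs.v *)
From HB Require Import structures.
From mathcomp Require Import all_boot all_order all_algebra.
From mathcomp Require Import interval_inference.
From mathcomp Require Import all_classical all_reals all_analysis.

Set Implicit Arguments.
Unset Strict Implicit.
Unset Printing Implicit Defensive.
Import Order.TTheory GRing.Theory Num.Theory.
Import numFieldNormedType.Exports.

Local Open Scope classical_set_scope.
Local Open Scope ring_scope.

(* Nonempty metric spaces: measurable types are pointed in the library. *)
#[short(type="pmetricType")]
HB.structure Definition PMetric (K : numDomainType) :=
  {M of Metric K M & Pointed M}.

Lemma mnormalizeE d (Y : measurableType d) (R : realType)
    (mu : {measure set Y -> \bar R}) (P : probability Y R) (r : R) (A : set Y) :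
  mu setT = r%:E -> r != 0 -> mnormalize mu P A = ((r^-1)%:E * mu A)%E.
Proof. by move=> muT r0; rewrite /mnormalize muT eqe (negbTE r0)/= muleC. Qed.

Section BorelProbabilities.
Context {R : realType} (X : pmetricType R).

Definition borel := g_sigma_algebraType (@open X).

Definition integral_functional (mu : probability borel R) :
    {ptws {f : X -> R | continuous f} -> R} :=
  fun f => \int[mu]_x (sval f x).

(* The weak-star topology on Borel probability measures: the coarsest topology
   making mu |-> \int f dmu continuous for every continuous f : X -> R. *)
Definition prob_space : topologicalType := initial_topology integral_functional.

End BorelProbabilities.

Section Dynamics.
Context {R : realType} {X : pmetricType R} (T : X -> X).
Implicit Types (n : nat) (x : X) (e : R) (A : set X) (C : set (set X)).

(* (1/n) \sum_(i < n) \d_(T^i x) for n >= 1, see empiricalE; the value at n = 0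
   is the irrelevant default \d_x. *)
Definition empirical n x : prob_space X :=
  mnormalize
    (msum (fun i => \d_(iter i T x : borel X) : {measure set (borel X) -> \bar R}) n)
    (\d_(x : borel X) : probability (borel X) R).

Lemma empiricalE n x (A : set (borel X)) : (0 < n)%N ->
  (empirical n x : probability (borel X) R) A =
  ((n%:R^-1)%:E * \sum_(i < n) (\d_(iter i T x : borel X) : set (borel X) -> \bar R) A)%E.
Proof.
move=> n0; apply: mnormalizeE; last by rewrite pnatr_eq0 -lt0n.
rewrite /= /msum (eq_bigr (fun=> 1%E)) => [|i _]; last exact: diracT.
by rewrite sumEFin sumr_const card_ord.
Qed.

Definition bowen_ball n x e : set X :=
  [set y | forall i, (i < n)%N -> mdist (iter i T x) (iter i T y) < e].

Definition separated_sets n e : set (set X) :=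
  [set A | forall x y, A x -> A y -> x <> y -> ~ bowen_ball n x e y].

Definition spanning_sets n e : set (set X) :=
  [set A | forall x, exists2 y, A y & bowen_ball n x e y].

Definition family_join (C D : set (set X)) : set (set X) :=
  [set U `&` V | U in C & V in D].

(* \bigvee_(i < n) T^-i C; the neutral element of the join is {X}. *)
Definition dynamical_join C n : set (set X) :=
  \big[family_join/[set setT]]_(i < n) [set iter i T @^-1` U | U in C].

Definition refines (C D : set (set X)) :=
  forall U, C U -> exists2 V, D V & U `<=` V.

Definition borel_cover : set (set (set X)) :=
  [set C | [/\ finite_set C,
               C `<=` (measurable : set (set (borel X))) &
               \bigcup_(U in C) U = setT]].

Definition open_cover : set (set (set X)) :=
  [set C | borel_cover C /\ C `<=` open].

Definition diameter A : R := sup [set mdist x y | x in A & y in A].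

Definition cover_diameter C : R := sup [set diameter U | U in C].

Section Pressure.
Variable E : prob_space X -> R.

Definition weight n x : R := expR (n%:R * E (empirical n x)).

Definition growth_rate (u : nat -> \bar R) : \bar R :=
  limn_esup (fun n => ((n%:R^-1)%:E * lne (u n))%E).

Definition Pn n e : \bar R :=
  ereal_sup [set \esum_(x in A) (weight n x)%:E | A in separated_sets n e].

Definition Qn n e : \bar R :=
  ereal_inf [set \esum_(x in A) (weight n x)%:E | A in spanning_sets n e].

Definition pressure : \bar R :=
  lim (growth_rate (Pn ^~ e) @[e --> 0^'+]).

Definition spanning_pressure : \bar R :=
  lim (growth_rate (Qn ^~ e) @[e --> 0^'+]).

(* The suprema and infima are those of R, where the empty set has supremum and
   infimum 0: an empty element of a cover contributes nothing to the sum. For a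
   nonempty A the weights are bounded when X is compact, T and E continuous. *)
Definition sup_weight n A : R := sup [set weight n x | x in A].

Definition inf_weight n A : R := inf [set weight n x | x in A].

Definition refining_covers n C : set (set (set X)) :=
  [set D | borel_cover D /\ refines D (dynamical_join C n)].

Definition finite_subcovers n C : set (set (set X)) :=
  [set D | [/\ finite_set D, D `<=` dynamical_join C n &
               \bigcup_(U in D) U = setT]].

Definition pn1 C n : \bar R :=
  ereal_inf [set (\sum_(V \in D) (sup_weight n V)%:E)%E
            | D in refining_covers n C].

Definition pn2 C n : \bar R :=
  ereal_inf [set (\sum_(V \in D) (inf_weight n V)%:E)%E
            | D in refining_covers n C].

Definition pn3 C n : \bar R :=
  ereal_inf [set (\sum_(V \in D) (sup_weight n V)%:E)%E
            | D in finite_subcovers n C].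

Definition pn4 C n : \bar R :=
  ereal_inf [set (\sum_(V \in D) (inf_weight n V)%:E)%E
            | D in finite_subcovers n C].

Variant cover_kind := kind1 | kind2 | kind3 | kind4.

Definition cover_pressure (i : cover_kind) C : \bar R :=
  growth_rate (match i with
               | kind1 => pn1 | kind2 => pn2 | kind3 => pn3 | kind4 => pn4
               end C).

Lemma bowen_ball_le n x e e' : e <= e' -> bowen_ball n x e `<=` bowen_ball n x e'.
Proof. by move=> ee' y xy i /xy /lt_le_trans; apply. Qed.

Lemma growth_rate_le (u v : nat -> \bar R) :
  (forall n, 0 <= u n)%E -> (forall n, u n <= v n)%E ->
  (growth_rate u <= growth_rate v)%E.
Proof.
move=> u0 uv; rewrite /growth_rate !limn_esup_lim; apply: lee_lim.
- exact: is_cvg_esups.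
- exact: is_cvg_esups.
near=> m; apply: ge_ereal_sup => _ [k /= mk <-].
apply: le_trans (ereal_sup_ubound _); last by exists k; [exact: mk|reflexivity].
apply: lee_wpmul2l; first by rewrite lee_fin.
by rewrite lee_lne ?uv// in_itv/= leey andbT// (le_trans (u0 k)).
Unshelve. all: by end_near. Qed.

Lemma is_cvg_pressure : cvg (growth_rate (Pn ^~ e) @[e --> 0^'+]).
Proof.
apply: nonincreasing_at_right_is_cvge; near=> r => e e' _ _ ee'.
apply: growth_rate_le => n.
  apply: le_trans (ereal_sup_ubound _); last first.
    by exists set0; [move=> ? ? []|reflexivity].
  by rewrite esum_set0.
apply: ereal_sup_le => _ [A sA <-]; exists A => // x y Ax Ay xy.
by apply: contra_not (sA _ _ Ax Ay xy); exact: bowen_ball_le.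
Unshelve. all: by end_near. Qed.

Lemma is_cvg_spanning_pressure : cvg (growth_rate (Qn ^~ e) @[e --> 0^'+]).
Proof.
apply: nonincreasing_at_right_is_cvge; near=> r => e e' _ _ ee'.
apply: growth_rate_le => n.
  apply: le_ereal_inf_tmp => _ [A _ <-]; apply: esum_ge0 => x _.
  by rewrite lee_fin expR_ge0.
apply: ereal_inf_le_tmp => _ [A sA <-]; exists A => // x.
by have [y Ay xy] := sA x; exists y => //; exact: bowen_ball_le xy.
Unshelve. all: by end_near. Qed.

End Pressure.
End Dynamics.

(* Main.v *)
(* By weak-star compactness the energy varies little between empirical measures
   of orbits that stay e-close, uniformly in the length n: points of a Bowen
   ball have weights equal up to a factor exp (n eta), and eta is arbitrary.

   Granting this, maximal separated sets are spanning (Q <= P); sending a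
   separated set into a spanning set of half the scale gives P <= Q + eta, and
   sending it into a cover of small diameter gives P <= P_2 + eta. For any open
   cover, fitting Bowen balls of its Lebesgue number into the elements of the
   iterated join gives P_4 <= Q, with no restriction on the diameter; small
   diameter is only used for P_3 <= P_4 + eta. The bound on P_1 for an arbitrary
   cover comes from passing to a finer one of small diameter.

   Compactness is obtained without the Riesz representation theorem: X is a
   continuous image of the Cantor space, so the ultralimit of the empirical
   measures can be taken on the clopen subsets of the Cantor space and extended
   by Caratheodory. *)

Require Import Defs.
From HB Require Import structures.
From mathcomp Require Import all_boot all_order all_algebra.
From mathcomp Require Import finmap.
From mathcomp Require Import all_classical all_reals all_analysis.
From mathcomp Require Import measurable_realfun ring lra.
Import Order.TTheory GRing.Theory Num.Theory.
Import numFieldNormedType.Exports.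
Local Open Scope classical_set_scope.
Local Open Scope ring_scope.

Set Implicit Arguments.
Unset Strict Implicit.
Unset Printing Implicit Defensive.

(** * Measures on zero-dimensional compact spaces *)

(** The alias takes the clopen sets of [K] as its measurable sets: an algebra of sets, on which a
    content can be extended by Caratheodory. *)
Definition clopen_type (K : ptopologicalType) : Type := K.

Lemma clopen_setC (K : ptopologicalType) : setC_closed (@clopen K).
Proof. by move=> A cA; exact: clopenC. Qed.

HB.instance Definition _ (K : ptopologicalType) :=
  Pointed.on (clopen_type K).
HB.instance Definition _ (K : ptopologicalType) :=
  isAlgebraOfSets.Build default_measure_display (clopen_type K)
    (@clopen0 K) (@clopenU K) (@clopen_setC K).

Local Notation clopen_sigma K :=
  (g_sigma_algebraType (@measurable _ (clopen_type K))).

(** A closed union is compact, so finitely many of the open pieces already cover it; by disjointness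
    all later pieces are empty. *)
Lemma clopen_bigcup_finite (K : ptopologicalType) (F : nat -> set K) :
  compact [set: K] -> (forall i, clopen (F i)) -> trivIset setT F ->
  clopen (\bigcup_i F i) -> exists N, forall i, (N <= i)%N -> F i = set0.
Proof.
move=> cK cF tF [oU cU].
have : compact (\bigcup_i F i) by apply: (subclosed_compact cU cK).
rewrite compact_cover => /(_ nat setT F) [i _||D _ UD].
- by have [] := cF i.
- by [].
exists (\max_(i <- finmap.enum_fset D) i).+1 => i Di; apply/seteqP;
  split => // z Fz.
have [j /= jD Fjz] := UD z (ex_intro2 _ _ i I Fz).
have ij : i = j by apply: (tF i j) => //; exists z.
have : (j <= \max_(i <- finmap.enum_fset D) i)%N by exact: leq_bigmax_seq.
by rewrite leqNgt -ij Di.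
Qed.

(** By [clopen_bigcup_finite] a countable disjoint union inside the algebra is a finite one, so
    finite additivity is all that the extension theorem asks for. *)
Lemma clopen_measure (R : realType) (K : ptopologicalType) (m : set K -> R) :
  compact [set: K] -> (forall A, 0 <= m A) ->
  (forall A B, clopen A -> clopen B -> A `&` B = set0 ->
    m (A `|` B) = m A + m B) ->
  exists mu : {measure set (clopen_sigma K) -> \bar R},
    forall A, clopen A -> mu A = (m A)%:E.
Proof.
move=> cK m_ge0 mU.
have m0 : m set0 = 0.
  apply: (@addrI _ (m set0)); rewrite -mU ?setUid ?addr0 ?setIid//.
  - exact: clopen0.
  - exact: clopen0.
pose m' (A : set (clopen_type K)) : \bar R := (m A)%:E.
have m'0 : m' set0 = 0%E by rewrite /m' m0.
have m'_ge0 A : (0 <= m' A)%E by rewrite lee_fin.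
have m'sum (F : nat -> set K) n : (forall i, clopen (F i)) -> trivIset setT F ->
    clopen (\big[setU/set0]_(0 <= i < n) F i) /\
    (\sum_(0 <= i < n) m' (F i))%E = m' (\big[setU/set0]_(0 <= i < n) F i).
  move=> cF tF; elim: n => [|n [cn IHn]].
    by rewrite !big_nil; split => //; exact: clopen0.
  rewrite !big_nat_recr//=; split; first exact: clopenU.
  rewrite IHn /m' -EFinD -mU//; apply/seteqP; split => // z [].
  rewrite big_mkord -bigcup_mkord => -[j /= jn Fj] Fn.
  have /= jn' : j = n by apply: (tF j n) => //; exists z.
  by rewrite jn' ltnn in jn.
have m'sigma : semi_sigma_additive m'.
  move=> F mF tF mUF.
  have [N FN] := clopen_bigcup_finite cK mF tF mUF.
  apply: cvg_near_cst; near=> n.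
  rewrite (m'sum F n mF tF).2; congr m'.
  rewrite big_mkord -bigcup_mkord; apply/seteqP;
    split => [z [i _ Fz]|z [i _ Fz]]; exists i => //=.
  rewrite ltnNge; apply/negP => ni.
  have Ni : (N <= i)%N by apply: leq_trans ni; near: n; exact: nbhs_infty_ge.
  by move: Fz; rewrite FN.
pose M : {measure set (clopen_type K) -> \bar R} :=
  HB.pack m' (isMeasure.Build _ _ _ m' m'0 m'_ge0 m'sigma).
exists (measure_extension M) => A cA.
by rewrite /= /measure_extension measurable_mu_extE.
Unshelve. all: by end_near. Qed.

Section zero_dimensional_compact.
Context (R : realType) (K : ptopologicalType).
Hypotheses (cK : compact [set: K]) (hK : hausdorff_space K)
  (zK : zero_dimensional K).

Lemma clopen_nbhs (z : K) (A : set K) : nbhs z A ->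
  exists C, [/\ clopen C, C z & C `<=` A].
Proof. by move=> /(zero_dimensional_cvg hK zK cK)[C [Cz cC] CA]; exists C. Qed.

(** Cover the compact set [F] by clopen neighbourhoods lying in [U]; the union of a finite subcover
    is still clopen. *)
Lemma clopen_between (F U : set K) : closed F -> open U -> F `<=` U ->
  exists C, [/\ clopen C, F `<=` C & C `<=` U].
Proof.
move=> cF oU FU.
have /choice[C CP] : forall z : K, exists C : set K,
    clopen C /\ (F z -> C z /\ C `<=` U).
  move=> z; have [Fz|nFz] := pselect (F z); last first.
    by exists set0; split => //; exact: clopen0.
  have [C [cC Cz CU]] := clopen_nbhs (open_nbhs_nbhs (conj oU (FU _ Fz))).
  by exists C.
have : compact F by apply: (subclosed_compact cF cK).
rewrite compact_cover => /(_ K F C) [z _|z Fz|D DF FD].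
- by have [[]] := CP z.
- by exists z => //; have [_ /(_ Fz)[]] := CP z.
exists (\bigcup_(i in [set` D]) C i); split => //; last first.
  by move=> z [i /DF/set_mem Fi]; have [_ /(_ Fi)[_]] := CP i; exact.
split; first by apply: bigcup_open => i _; have [[]] := CP i.
by apply: closed_bigcup => // i _; have [[]] := CP i.
Qed.

(** A union of arbitrarily many clopen sets could leave the sigma-algebra. Writing [U] as an F-sigma
    set and inserting a clopen set between each closed piece and [U] makes the union countable. *)
Lemma clopen_sigma_open (U : set K) (F : nat -> set K) : open U ->
  (forall n, closed (F n)) -> \bigcup_n F n = U ->
  measurable (U : set (clopen_sigma K)).
Proof.
move=> oU cF FU.
have /choice[C CP] : forall n, exists C, [/\ clopen C, F n `<=` C & C `<=` U].
  by move=> n; apply: clopen_between => //; rewrite -FU; exact: bigcup_sup.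
have -> : U = \bigcup_n C n.
  apply/seteqP; split => [z|z [n _]]; last by have [_ _] := CP n; exact.
  by rewrite -FU => -[n _ Fz]; exists n => //; have [_ + _] := CP n; exact.
apply: bigcupT_measurable => n; apply: sub_sigma_algebra.
by have [] := CP n.
Qed.

(* Successive differences make the clopen pieces disjoint, so that a point is
   only charged with the value attached to the first piece containing it. *)
Lemma clopen_step (g : K -> R) (C : nat -> set K) (x : nat -> K) (e : R) N z :
  (forall i z, C i z -> `|g z - g (x i)| <= e) ->
  let h := \sum_(i < N) g (x i) * \1_(C i `\` \bigcup_(j < i) C j) z in
  if pselect (exists2 i, (i < N)%N & C i z) then is_true (`|g z - h| <= e) else
    h = 0.
Proof.
move=> gC; elim: N => [|N] /=.
  by rewrite big_ord0; case: pselect => //= -[].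
rewrite big_ord_recr/=; set h := \sum_(i < N) _.
case: pselect => [[i iN Ciz] hz|nex h0]; case: pselect => //=.
- move=> _; rewrite indicE memNset ?mulr0 ?addr0//= => -[_].
  by apply; exists i.
- by move=> nex; exfalso; apply: (nex); exists i => //; exact: ltnW.
- move=> [i iN Ciz]; rewrite h0 add0r indicE mem_set ?mulr1.
    rewrite gC//; move: (iN); rewrite ltnS leq_eqVlt => /orP[/eqP <-//|iN'].
    by exfalso; apply: (nex); exists i.
  split=> [|[j /= jN Cj]]; last by apply: (nex); exists j.
  move: (iN); rewrite ltnS leq_eqVlt => /orP[/eqP <-//|iN'].
  by exfalso; apply: (nex); exists i.
- move=> nex'; rewrite h0 add0r indicE memNset ?mulr0// => -[CN _].
  by apply: nex'; exists N.
Qed.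

(** The error is uniform in [z], so that it can be paid both under an integral and under a mean
    functional. *)
Lemma clopen_step_approx (g : K -> R) (e : R) : continuous g -> 0 < e ->
  exists N (c : nat -> R) (C : nat -> set K), (forall i, clopen (C i)) /\
    forall z, `|g z - \sum_(i < N) c i * \1_(C i) z| <= e.
Proof.
move=> cg e0.
have /choice[C CP] : forall x : K, exists C : set K,
    [/\ clopen C, C x & forall z, C z -> `|g z - g x| <= e].
  move=> x; have /cvgr_dist_le/(_ _ e0) := cg x.
  move=> /clopen_nbhs[C [cC Cx CP]]; exists C; split => // z /CP.
  by rewrite /= distrC.
have := cK; rewrite compact_cover => /(_ K setT C) [x _|x _|D _ TD].
- by have [[]] := CP x.
- by exists x => //; have [] := CP x.
pose s := finmap.enum_fset D; pose x i := nth point s i.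
exists (size s), (g \o x), (fun i => C (x i) `\` \bigcup_(j < i) C (x j)).
split=> [i|z].
  have cC y : clopen (C y) by have [] := CP y.
  apply: clopenI => //; apply: (@clopenC _ _ set0); rewrite bigcup_mkord.
  elim/big_ind : _ => //; first exact: clopen0.
  by move=> *; exact: clopenU.
have := @clopen_step g (C \o x) x e (size s) z; case: pselect => /=.
  by move=> _; apply => i y; have [_ _] := CP (x i); exact.
move=> []; have [y /= yD Cyz] := TD z I.
by exists (index y s); rewrite ?index_mem// /x nth_index.
Qed.

End zero_dimensional_compact.

(** * Borel sets of a metric space and integrals of bounded functions *)

Section metric_borel.
Context (R : realType) (X : pmetricType R).

Lemma open_mball (x : X) (e : R) : open [set y | mdist x y < e].
Proof.
rewrite openE => y /= xy; rewrite /interior/= -nbhs_ballE.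
exists (e - mdist x y); first by rewrite /= subr_gt0.
move=> z; rewrite ballEmdist/= => yz.
by rewrite (le_lt_trans (metric_triangle x y z))// -ltrBrDl.
Qed.

(** The closed sets collect the points at distance at least [1/(n+1)] from every point of the
    complement of [U]. *)
Lemma open_bigcup_closed (U : set X) : open U ->
  exists F : nat -> set X, (forall n, closed (F n)) /\ \bigcup_n F n = U.
Proof.
move=> oU.
exists (fun n => \bigcap_(y in ~` U) ~` [set x | mdist y x < n.+1%:R^-1]).
split=> [n|].
  by apply: closed_bigI => y _; apply: open_closedC; exact: open_mball.
apply/seteqP; split => [x [n _ Fx]|x Ux].
  apply: contrapT => nUx; apply: (Fx x nUx).
  by rewrite /= mdistxx invr_gt0.
have : nbhs x U by exact: open_nbhs_nbhs.
rewrite -nbhs_ballE => -[e /= e0 xeU].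
have [n ne] : exists n, n.+1%:R^-1 < e.
  exists (Num.truncn e^-1).
  by rewrite invf_plt ?posrE// truncnS_gt.
exists n => // y nUy /= yx; apply: nUy; apply: xeU.
by rewrite ballEmdist/= metric_sym (lt_trans yx).
Qed.

Lemma continuous_borel (f : X -> R) : continuous f ->
  measurable_fun setT (f : borel X -> R).
Proof.
move=> /continuousP cf; apply: (measurability _ (RGenOpens.measurableE R)).
move=> _ [_ [x [y ->]] <-]; rewrite setTI; apply: sub_sigma_algebra.
exact/cf/interval_open.
Qed.

(** Open sets of [X] are F-sigma because [X] is metric; their preimages inherit this, which is what
    [clopen_sigma_open] requires. *)
Lemma clopen_borel (K : ptopologicalType) (phi : K -> X) :
  compact [set: K] -> hausdorff_space K -> zero_dimensional K ->
  continuous phi -> measurable_fun setT (phi : clopen_sigma K -> borel X).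
Proof.
move=> cK hK zK cphi;
  apply: (@measurability _ _ _ (borel X) _ _ (@open X)) => //.
move=> _ [U oU <-]; rewrite setTI.
have [F [cF FU]] := open_bigcup_closed oU.
apply: (@clopen_sigma_open K cK hK zK _ (fun n => phi @^-1` F n)).
- by move/continuousP : cphi; exact.
- by move=> n; apply: closed_comp => // x _; exact: cphi.
- by rewrite -preimage_bigcup FU.
Qed.

End metric_borel.

Lemma Rintegral_dist d (Y : measurableType d) (R : realType)
    (mu : probability Y R) (f g : Y -> R) (e : R) :
  mu.-integrable setT (EFin \o f) -> mu.-integrable setT (EFin \o g) ->
  (forall y, `|f y - g y| <= e) ->
  `|\int[mu]_y f y - \int[mu]_y g y| <= e.
Proof.
move=> mf mg fg; rewrite -RintegralB//.
have mfg : mu.-integrable setT (EFin \o (fun y => f y - g y)).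
  by have := integrableB measurableT mf mg.
rewrite (le_trans (le_normr_Rintegral _ mfg))//.
rewrite (_ : e = \int[mu]_(y in setT) e); last first.
  by rewrite Rintegral_cst// [X in fine X]probability_setT mulr1.
apply: le_Rintegral => //.
- exact: (integrable_norm mfg).
- exact: finite_measure_integrable_cst.
Qed.

Lemma integrable_bounded d (Y : measurableType d) (R : realType)
    (mu : probability Y R) (f : Y -> R) (M : R) :
  measurable_fun setT f -> (forall y, `|f y| <= M) ->
  mu.-integrable setT (EFin \o f).
Proof.
move=> mf fM; apply: measurable_bounded_integrable => //.
  by rewrite [ltLHS]probability_setT ltry.
by exists M; split; rewrite ?num_real// => N MN y _;
  rewrite /= (le_trans (fM y))// ltW.
Qed.

Lemma Rintegral_step d (Y : measurableType d) (R : realType)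
    (mu : probability Y R) N (c : nat -> R) (C : nat -> set Y) :
  (forall i, measurable (C i)) ->
  let h y := \sum_(i < N) c i * \1_(C i) y in
  mu.-integrable setT (EFin \o h) /\
  \int[mu]_y h y = \sum_(i < N) c i * fine (mu (C i)).
Proof.
move=> mC; have iC i : mu.-integrable setT (EFin \o (\1_(C i) : Y -> R)).
  apply: (@integrable_bounded _ _ _ mu _ 1) => [|y]; last first.
    by rewrite indicE; case: (_ \in _); rewrite ?normr1// normr0.
  exact: measurable_indic.
elim: N => [|N [iN eN]] /=.
  split; first by under eq_fun do rewrite big_ord0; exact: integrable0.
  rewrite (@eq_Rintegral _ _ _ mu setT (cst 0)) => [|y _];
    last by rewrite big_ord0.
  by rewrite Rintegral_cst// mul0r big_ord0.
have iN' : mu.-integrable setT (EFin \o (fun y => c N * \1_(C N) y)).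
  by have := integrableZl measurableT (c N) (iC N).
under eq_fun do rewrite big_ord_recr/=.
split; first by have := integrableD measurableT iN iN'.
rewrite RintegralD// eN big_ord_recr/= RintegralZl//; congr (_ + _ * _).
by rewrite /Rintegral integral_indic// setIT.
Qed.

(** * Weak-star limits of mean functionals *)

(** The functional acts on all functions, not only on continuous ones: it will be evaluated on
    indicators composed with a section that may be discontinuous. *)
Definition mean_functional (R : realType) (X : Type) (A : (X -> R) -> R) :=
  [/\ A (cst 1) = 1,
      forall a f g, A (fun x => a * f x + g x) = a * A f + A g &
      forall f, (forall x, 0 <= f x) -> 0 <= A f].

Section mean_functional.
Context (R : realType) (X : Type) (A : (X -> R) -> R).
Hypothesis meanA : mean_functional A.

Lemma mean_functional_le f g : (forall x, f x <= g x) -> A f <= A g.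
Proof.
have [_ A_linear A_ge0] := meanA => fg.
have -> : g = (fun x => 1 * f x + (g x - f x)).
  by apply/funext => x; rewrite mul1r addrC subrK.
by rewrite A_linear mul1r lerDl A_ge0// => x; rewrite subr_ge0.
Qed.

Lemma mean_functional_sum N (c : nat -> R) (f : nat -> X -> R) :
  A (fun x => \sum_(i < N) c i * f i x) = \sum_(i < N) c i * A (f i).
Proof.
have [_ A_linear _] := meanA.
elim: N => [|N IHN].
  under eq_fun do rewrite big_ord0; rewrite big_ord0.
  (* Linearity in the form [a f + g], taken at [a = -1] and [f = g = 0], yields [A 0 = 0]. *)
  have -> : (fun=> 0 : R) = (fun x : X => -1 * 0 + 0).
    by apply/funext => x; rewrite mulr0 addr0.
  by rewrite A_linear mulN1r addNr.
under eq_fun do rewrite big_ord_recr/= addrC.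
by rewrite A_linear IHN big_ord_recr/= addrC.
Qed.

Lemma mean_functional_cst e : A (fun=> e) = e.
Proof.
have [A1 _ _] := meanA.
have -> : (fun=> e) = (fun x : X => \sum_(i < 1) e * cst 1 x).
  by apply/funext => x; rewrite big_ord_recl big_ord0 mulr1 addr0.
rewrite (mean_functional_sum 1 (fun=> e) (fun=> cst 1)).
by rewrite big_ord_recl big_ord0 A1 mulr1 addr0.
Qed.

Lemma mean_functional_dist f g e :
  (forall x, `|f x - g x| <= e) -> `|A f - A g| <= e.
Proof.
have [A1 A_linear _] := meanA => fg.
have AD h : A (fun x => 1 * h x + e) = A h + e.
  by rewrite (A_linear 1 h (fun=> e)) mul1r mean_functional_cst.
rewrite ler_distlC; apply/andP; split.
  rewrite lerBlDr -AD; apply: mean_functional_le => x.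
  by rewrite /= mul1r; have := fg x; rewrite ler_distlC => /andP[+ _];
    rewrite lerBlDr.
rewrite -AD; apply: mean_functional_le => x.
by rewrite /= mul1r; have := fg x; rewrite ler_distlC => /andP[].
Qed.

End mean_functional.

Lemma ultra_fmap (I J : Type) (F : set_system I) (f : I -> J) :
  UltraFilter F -> UltraFilter (f @ F).
Proof.
move=> UF; split; first exact: fmap_proper_filter.
move=> G PG FG; apply/seteqP; split => // B GB.
have [//|nB] := in_ultra_setVsetC (f @^-1` B) UF.
have /FG GnB : (f @ F) (~` B) by [].
by have [y []] := filter_ex (filterI GB GnB).
Qed.

Lemma ultra_bounded_cvg (R : realType) (I : Type) (F : set_system I)
    (f : I -> R) (a b : R) : UltraFilter F ->
  (forall i, a <= f i <= b) -> cvg (f @ F).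
Proof.
move=> UF fab; have UfF := ultra_fmap f UF.
have := @segment_compact _ a b; rewrite compact_ultra => /(_ (f @ F) UfF).
case.
  apply: (@filterS _ F _ setT) => [i _|]; last exact: filterT.
  by rewrite /= in_itv/=.
by move=> l [_ Fl]; apply/cvg_ex; exists l.
Qed.

(* The limit functional is realized on the Cantor space K, which maps onto X: on
   the clopen subsets of K, its finite additivity is countable additivity. *)
Lemma weak_limit_exists (R : realType) (X : pmetricType R) (I : Type)
    (F : set_system I) (A : I -> (X -> R) -> R) :
  compact [set: X] -> UltraFilter F -> (forall i, mean_functional (A i)) ->
  exists mu : probability (borel X) R, forall f : X -> R, continuous f ->
    A i f @[i --> F] --> \int[mu]_x f x.
Proof.
move=> cX UF meanA; pose K : ptopologicalType := cantor_space.
have cK : compact [set: K] := cantor_space_compact.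
have hK : hausdorff_space K := cantor_space_hausdorff.
have zK : zero_dimensional K := cantor_zero_dimensional.
have [phi cphi] := cantor_surj cX (@metric_hausdorff R X).
(* A mere set-theoretic section of [phi]. It transports each [A i] to a finitely additive content
   [a C i] on the clopen sets of [K]. *)
have /choice[s phis] : forall x : X, exists z : K, phi z = x.
  by move=> x; have [z _ <-] := @surj _ _ _ _ phi x Logic.I; exists z.
pose a (C : set K) i := A i (\1_C \o s).
have a01 C i : 0 <= a C i <= 1.
  have [A1 _ A_ge0] := meanA i; apply/andP; split.
    by apply: A_ge0 => x; rewrite /= indicE.
  rewrite -A1; apply: (mean_functional_le (meanA i)) => x.
  by rewrite /= indicE; case: (_ \in _).
pose m C := lim (a C @ F).
have am C : a C @ F --> m C by exact: (ultra_bounded_cvg UF (a01 C)).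
have [mu0 mu0E] : exists mu : {measure set (clopen_sigma K) -> \bar R},
    forall C, clopen C -> mu C = (m C)%:E.
  apply: clopen_measure => // [C|C D _ _ CD].
    by apply: (cvgr_to_ge (am C)); near=> i; have /andP[] := a01 C i.
  apply/esym; apply: (cvg_unique _ (cvgD (am C) (am D))).
    exact: norm_hausdorff.
  apply: cvg_trans (am (C `|` D)); apply: near_eq_cvg; near=> i.
  have [_ A_linear _] := meanA i.
  change (A i (\1_(C `|` D) \o s) = A i (\1_C \o s) + A i (\1_D \o s)).
  rewrite -[X in X + _]mul1r -A_linear; congr (A i _).
  apply/funext => x; rewrite /= !indicE in_setU mul1r.
  case: (boolP (s x \in C)) => xC; case: (boolP (s x \in D)) => xD;
    rewrite ?addr0 ?add0r//.
  by move: xC xD => /set_mem xC /set_mem xD; have : (C `&` D) (s x) by [];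
    rewrite CD.
have mu01 : mu0 setT = 1%E.
  rewrite mu0E; last exact: clopenT.
  congr EFin; apply: (cvg_unique _ (am setT)); first exact: norm_hausdorff.
  apply: cvg_near_cst; near=> i; have [A1 _ _] := meanA i.
  by rewrite /a -A1; congr (A i _); apply/funext => x; rewrite /= indicT.
(* The total mass is already 1: normalizing keeps the values of [mu0] and supplies the structure of
   a probability. *)
pose P0 : probability (clopen_sigma K) R :=
  mnormalize mu0 (\d_(point : clopen_sigma K)).
have P0E C : clopen C -> P0 C = (m C)%:E.
  move=> cC; rewrite /P0 /= (mnormalizeE _ _ mu01) ?oner_neq0//.
  by rewrite invr1 mul1e mu0E.
have mphi := clopen_borel cK hK zK cphi.
pose phim : {mfun (clopen_sigma K) >-> (borel X)} :=
  HB.pack (phi : clopen_sigma K -> borel X) (isMeasurableFun.Build _ _ _ _ (phi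
    : clopen_sigma K -> borel X) mphi).
exists (distribution P0 phim) => f cf.
have cg : continuous (f \o phi).
  by move=> z; apply: continuous_comp; [exact: cphi|exact: cf].
have mf := continuous_borel cf.
have [M fM] : exists M, forall x, `|f x| <= M.
  have /compact_bounded[M [_ fM]] : compact (f @` setT).
    by apply: continuous_compact => //; exact: continuous_subspaceT.
  exists (M + 1) => x; apply: fM; first by rewrite ltrDl.
  by exists x.
have mg : measurable_fun setT (f \o phi : clopen_sigma K -> R).
  exact: (measurableT_comp mf mphi).
have intE : \int[distribution P0 phim]_x f x = \int[P0]_z f (phi z).
  rewrite /Rintegral integral_pushforward//.
    exact/measurable_EFinP.
  apply: (@integrable_bounded _ _ _ P0 (f \o phi) M) => [|z]; last exact: fM.
  exact: mg.
rewrite intE; apply/cvgrPdist_le => e e0.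
(* One third each for replacing [f \o phi] by a step function under [P0], for the convergence of the
   masses of its finitely many pieces, and for the same replacement under [A i]. *)
have e3 : 0 < e / 3 by rewrite divr_gt0.
have [N [c [C [cC gC]]]] := clopen_step_approx cK hK zK cg e3.
have mC i : measurable (C i : set (clopen_sigma K)).
  by apply: sub_sigma_algebra; exact: cC.
have [ih hE] := Rintegral_step P0 N c mC.
have ig : P0.-integrable setT (EFin \o (f \o phi)).
  apply: (@integrable_bounded _ _ _ P0 (f \o phi) M) => [|z]; last exact: fM.
  exact: mg.
have /= gh := Rintegral_dist ig ih gC.
have : (\sum_(j < N) c j * a (C j) i) @[i --> F] --> \sum_(j < N) c j * m (C j).
  apply: cvg_big => [|j _]; first exact: add_continuous.
  by apply: cvgMr; exact: am.
move=> /cvgrPdist_le/(_ _ e3).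
apply: filterS => i /= Ai.
(* Since [phi (s x) = x], the step function composed with [s] approximates [f] itself on [X]. *)
have Af : `|A i f - \sum_(j < N) c j * a (C j) i| <= e / 3.
  rewrite /a -(mean_functional_sum (meanA i) _ _ (fun j => \1_(C j) \o s)).
  apply: (mean_functional_dist (meanA i)) => x.
  by have := gC (s x); rewrite /= phis.
rewrite hE (eq_bigr (fun j : 'I_N => c j * m (C j))) in gh; last first.
  by move=> j _; rewrite P0E//; exact: cC.
rewrite [leRHS](_ : e = e / 3 + e / 3 + e / 3); last by field.
move: gh Ai Af; set u := Rintegral _ _ _; set v := \sum_(j < N) _.
set w := \sum_(j < N) _ => uv vw Aw.
have -> : u - A i f = (u - v) + (v - w) + (w - A i f) by ring.
apply: le_trans (ler_normD _ _) _; rewrite lerD//; last by rewrite distrC.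
by apply: le_trans (ler_normD _ _) _; rewrite lerD.
Unshelve. all: by end_near. Qed.

(** * Uniformity of the weights along Bowen balls *)

(** If the ball of radius [e] about [x] fits into a member of [C], then radii below [e / 2] fit at
    all points within [e / 2] of [x]; compactness makes this local choice uniform. *)
Lemma lebesgue_number (R : realType) (X : pmetricType R) (C : set (set X)) :
  compact [set: X] -> C `<=` open -> \bigcup_(U in C) U = setT ->
  exists2 r : R, 0 < r &
    forall x, exists2 U, C U & [set y | mdist x y < r] `<=` U.
Proof.
move=> cX oC CT.
have /(iffLR (compact_near_coveringP _)) cov := cX.
pose P (r : R) x := exists2 U, C U & [set y | mdist x y < r] `<=` U.
have : \forall r \near 0^'+, [set: X] `<=` P r.
  apply: cov => x _.
  have [U CU Ux] : (\bigcup_(U in C) U) x by rewrite CT.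
  have : nbhs x U by apply: open_nbhs_nbhs; split => //; exact: oC.
  rewrite -nbhs_ballE => -[e /= e0 xeU].
  exists (ball x (e / 2), [set r | r < e / 2]) => /=.
    split; first by apply: nbhsx_ballx; rewrite divr_gt0.
    by apply: nbhs_right_lt; rewrite divr_gt0.
  move=> [y r] /= [+ re]; rewrite ballEmdist/= => xy.
  exists U => // z /= yz; apply: xeU; rewrite ballEmdist/=.
  by rewrite (le_lt_trans (metric_triangle x y z))// (splitr e) ltrD//
    (lt_trans yz).
move=> /(filterI (nbhs_right_gt 0))/filter_ex[r [r0 Pr]].
by exists r => // x; exact: Pr.
Qed.

(** Take a Lebesgue number of the cover by the sets on which [f] stays within [e / 2] of one of its
    values. *)
Lemma uniformly_continuous (R : realType) (X : pmetricType R) (f : X -> R)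
    (e : R) : compact [set: X] -> continuous f -> 0 < e ->
  exists2 r : R, 0 < r & forall x y, mdist x y < r -> `|f x - f y| <= e.
Proof.
move=> cX cf e0; have e20 : 0 < e / 2 by rewrite divr_gt0.
pose C := [set f @^-1` ball (f x) (e / 2) | x in setT].
have [_ [x _ <-]||r r0 rC] := @lebesgue_number R X C cX.
- by apply: open_comp => [y _|]; [exact: cf|exact: ball_open].
- apply/seteqP; split => // x _; exists (f @^-1` ball (f x) (e / 2)).
    by exists x.
  exact: ballxx.
exists r => // x y xy; have [_ [z _ <-] xrU] := rC x.
have /xrU : mdist x x < r by rewrite mdistxx.
have /xrU : mdist x y < r by [].
rewrite /ball /= => zy zx.
rewrite (splitr e) -(subrKA (f z)) (le_trans (ler_normD _ _))//.
by rewrite lerD// ltW// distrC.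
Qed.

(** * Orbit averages and weak-star convergence *)

Section empirical.
Context (R : realType) (X : pmetricType R) (T : X -> X).

Definition orbit_mean n x (f : X -> R) :=
  n%:R^-1 * \sum_(i < n) f (iter i T x).

Lemma mean_functional_orbit n x : (0 < n)%N ->
  mean_functional (orbit_mean n x).
Proof.
move=> n0; have nn0 : (n%:R : R) != 0 by rewrite pnatr_eq0 -lt0n.
rewrite /orbit_mean; split=> [|a f g|f f0].
- by rewrite sumr_const card_ord mulVf.
- rewrite big_split/= -mulr_sumr; ring.
- by rewrite mulr_ge0 ?invr_ge0// sumr_ge0.
Qed.

Lemma orbit_mean_dist n x y (e : R) f : (0 < n)%N ->
  (forall i, (i < n)%N -> `|f (iter i T x) - f (iter i T y)| <= e) ->
  `|orbit_mean n x f - orbit_mean n y f| <= e.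
Proof.
move=> n0 fe; rewrite /orbit_mean -mulrBr -sumrB normrM ger0_norm ?invr_ge0//.
rewrite ler_pdivrMl ?ltr0n// (le_trans (ler_norm_sum _ _ _))//.
rewrite (le_trans (ler_sum _ (fun (i : 'I_n) _ => fe i (ltn_ord i))))//.
by rewrite sumr_const card_ord mulr_natl.
Qed.

Lemma integral_empirical n x (f : X -> R) : (0 < n)%N ->
  measurable_fun setT (f : borel X -> R) -> (forall y, 0 <= f y) ->
  (\int[empirical T n x : probability (borel X) R]_y (f y)%:E)%E =
  (orbit_mean n x f)%:E.
Proof.
move=> n0 mf f0.
have mEf : measurable_fun setT (EFin \o (f : borel X -> R)).
  exact/measurable_EFinP.
have rn : 0 <= n%:R^-1 :> R by rewrite invr_ge0.
rewrite (eq_measure_integral (mscale (NngNum rn) (msum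
    (fun i => \d_(iter i T x : borel X) : {measure set (borel X) -> \bar R})
      n))).
  rewrite ge0_integral_mscale//=; last by move=> *; rewrite lee_fin.
  rewrite ge0_integral_measure_sum//=; last by move=> *; rewrite lee_fin.
  rewrite /orbit_mean EFinM -sumEFin; congr (_ * _)%E; apply: eq_bigr => i _.
  by rewrite integral_dirac// diracT mul1e.
by move=> A mA _; exact: empiricalE.
Qed.

Lemma Rintegral_empirical n x (f : X -> R) : (0 < n)%N ->
  compact [set: X] -> continuous f ->
  \int[empirical T n x : probability (borel X) R]_y f y = orbit_mean n x f.
Proof.
move=> n0 cX cf.
have [M fM] : exists M, forall x, `|f x| <= M.
  have /compact_bounded[M [_ fM]] : compact (f @` setT).
    by apply: continuous_compact => //; exact: continuous_subspaceT.
  exists (M + 1) => y; apply: fM; first by rewrite ltrDl.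
  by exists y.
have mf := continuous_borel cf.
set mu := (empirical T n x : probability (borel X) R).
have if_ : mu.-integrable setT (EFin \o f).
  by apply: (@integrable_bounded _ _ _ mu (f : borel X -> R) M).
have iM : mu.-integrable setT (EFin \o (cst M : borel X -> R)).
  exact: finite_measure_integrable_cst.
have meanM g : orbit_mean n x (fun y => g y + M) = orbit_mean n x g + M.
  have mf_ := mean_functional_orbit x n0.
  have [_ lin _] := mf_.
  transitivity (orbit_mean n x (fun y => 1 * g y + M)).
    by congr orbit_mean; apply/funext => y; rewrite mul1r.
  by rewrite (lin 1 g (fun=> M)) mul1r (mean_functional_cst mf_).
(* Adding the bound [M] of [|f|] to both sides reduces to the nonnegative function [f + M]. *)
apply: (@addIr _ M); rewrite -meanM.
have <- : \int[mu]_y (f y + M) = orbit_mean n x (fun y => f y + M).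
  rewrite /Rintegral integral_empirical//.
    by apply: measurable_funD => //; exact: measurable_cst.
  by move=> y; rewrite -lerBlDr sub0r; have := fM y;
    rewrite ler_norml => /andP[].
rewrite RintegralD//; congr (_ + _).
by rewrite Rintegral_cst// [X in fine X]probability_setT mulr1.
Qed.

End empirical.

(** Neighbourhoods in the initial topology come from the topology of pointwise convergence, which is
    a supremum of topologies induced by evaluations; so convergence can be tested on one [f] at a
    time. *)
Lemma prob_space_cvg (R : realType) (X : pmetricType R) (I : Type)
    (F : set_system I) (nu : I -> prob_space X) (mu : prob_space X) :
  Filter F ->
  (forall f : X -> R, continuous f ->
    \int[nu i : probability (borel X) R]_x f x @[i --> F] -->
    \int[mu : probability (borel X) R]_x f x) ->
  nu @ F --> mu.
Proof.
move=> FF nu_mu A /= [_ [[B oB <-] Bmu BA]].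
have : integral_functional (X := X) \o nu @ F --> integral_functional (mu :
  probability (borel X) R).
  apply/cvg_sup => f; rewrite cvg_image; last first.
    by apply/seteqP; split => // v _; exists (fun=> v).
  move=> W /(nu_mu _ (svalP f)) FW.
  exists ((fun g => g f) @^-1` W); first exact: FW.
  apply/seteqP; split => [v [g Wg <-]//|v Wv]; by exists (fun=> v).
have nB : nbhs (integral_functional (mu : probability (borel X) R)) B.
  exact: open_nbhs_nbhs.
move=> /(_ B nB) FB; change (F (nu @^-1` A)).
by apply: (@filterS _ F _ _ _ _ FB) => i; exact: BA.
Qed.

(* Otherwise E separates two sequences of empirical measures whose orbits shadow
   each other ever more closely; along an ultrafilter both converge to the same
   measure, where E is continuous. *)
Lemma energy_uniform (R : realType) (X : pmetricType R) (T : X -> X)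
    (E : prob_space X -> R) (eta : R) :
  compact [set: X] -> continuous E -> 0 < eta ->
  exists2 e : R, 0 < e & forall n x y, (0 < n)%N -> bowen_ball T n x e y ->
    `|E (empirical T n x) - E (empirical T n y)| <= eta.
Proof.
move=> cX cE eta0; apply: contrapT => nex.
have /choice[p pP] : forall k, exists p : nat * (X * X),
    [/\ (0 < p.1)%N, bowen_ball T p.1 p.2.1 k.+1%:R^-1 p.2.2 &
      eta < `|E (empirical T p.1 p.2.1) - E (empirical T p.1 p.2.2)|].
  move=> k; apply: contrapT => nk; apply: nex.
  exists k.+1%:R^-1; first by rewrite invr_gt0.
  move=> n x y n0 xy; rewrite leNgt; apply/negP => Exy.
  by apply: nk; exists (n, (x, y)).
pose n k := (p k).1; pose x k := (p k).2.1; pose y k := (p k).2.2.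
have n0 k : (0 < n k)%N by have [] := pP k.
have [U [UU oU]] := @ultraFilterLemma nat \oo _.
have [mu muP] := weak_limit_exists cX UU
  (fun k => mean_functional_orbit T (x k) (n0 k)).
have xmu : empirical T (n k) (x k) @[k --> U] --> (mu : prob_space X).
  apply: prob_space_cvg => f cf.
  by under eq_fun do rewrite Rintegral_empirical//; exact: muP.
(* Uniform continuity of [f] bounds the difference of the two orbit averages term by term, whatever
   the lengths [n k]. *)
have ymu : empirical T (n k) (y k) @[k --> U] --> (mu : prob_space X).
  apply: prob_space_cvg => f cf.
  under eq_fun do rewrite Rintegral_empirical//.
  apply/cvgrPdist_le => e e0; have e2 : 0 < e / 2 by rewrite divr_gt0.
  have [r r0 fr] := uniformly_continuous cX cf e2.
  have /cvgrPdist_le/(_ _ e2) Ux := muP f cf.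
  have Ur : U [set k | k.+1%:R^-1 < r] by apply: oU;
    exact: (near_infty_natSinv_lt (PosNum r0)).
  apply: filterS2 Ux Ur => k /= xk kr.
  have xy : `|orbit_mean T (n k) (x k) f - orbit_mean T (n k) (y k) f| <= e / 2.
    apply: orbit_mean_dist => // i ik; apply: fr.
    by have [_ + _] := pP k; move=> /(_ i ik)/lt_trans; exact.
  rewrite (splitr e) -(subrKA (orbit_mean T (n k) (x k) f)).
  by rewrite (le_trans (ler_normD _ _))// lerD.
have Ex := cvg_comp _ _ xmu (cE mu).
have Ey := cvg_comp _ _ ymu (cE mu).
have /cvgrPdist_le/(_ _ eta0) : (fun k =>
  E (empirical T (n k) (x k)) - E (empirical T (n k) (y k))) @ U --> (0 : R).
  by rewrite -(subrr (E mu)); exact: cvgB Ex Ey.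
move=> /filter_ex[k]; rewrite sub0r normrN.
by have [_ _] := pP k; rewrite ltNge => /negP.
Qed.

Lemma weight_uniform (R : realType) (X : pmetricType R) (T : X -> X)
    (E : prob_space X -> R) (eta : R) :
  compact [set: X] -> continuous E -> 0 < eta ->
  exists2 e : R, 0 < e & forall n x y, bowen_ball T n x e y ->
    weight T E n x <= expR (n%:R * eta) * weight T E n y.
Proof.
move=> cX cE eta0; have [e e0 eE] := energy_uniform T cX cE eta0.
(* At [n = 0], not covered by [energy_uniform], all weights are 1. *)
exists e => // -[|n] x y xy; first by rewrite /weight !mul0r expR0 mul1r.
rewrite /weight -expRD ler_expR -mulrDr ler_wpM2l//.
by have := eE n.+1 x y isT xy; rewrite ler_norml lerBlDr => /andP[].
Qed.

(** * Covers and counting inequalities *)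

Lemma lne_rate_le (R : realType) n (u v : \bar R) (eta : R) : (0 < n)%N ->
  (0 <= u)%E -> (0 <= v)%E -> (u <= (expR (n%:R * eta))%:E * v)%E ->
  ((n%:R^-1)%:E * lne u <= (n%:R^-1)%:E * lne v + eta%:E)%E.
Proof.
move=> n0 u0 v0 uv; have rn : (0 < n%:R^-1 :> R) by rewrite invr_gt0 ltr0n.
(* If [u = 0] the left side is -oo; otherwise [v] is positive as well and the logarithm of the
   product splits. *)
have [->|uN0] := eqVneq u 0%E.
  by rewrite le0_lneNy// gt0_muleNy ?lte_fin// leNye.
have {}u0 : (0 < u)%E by rewrite lt_def uN0.
have v_gt0 : (0 < v)%E.
  rewrite lt_def v0 andbT; apply/eqP => v00.
  by move: (lt_le_trans u0 uv); rewrite v00 mule0 ltxx.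
apply: (@le_trans _ _ ((n%:R^-1)%:E * lne ((expR (n%:R * eta))%:E * v))%E).
  apply: lee_wpmul2l; first by rewrite lee_fin ltW.
  rewrite lee_lne ?in_itv/= ?leey ?andbT ?(ltW u0)//.
  by rewrite mule_ge0// lee_fin expR_ge0.
have pos (z : \bar R) : (0 < z)%E -> z \in `]0%E, +oo%E] by rewrite in_itv/=
  leey andbT.
rewrite lneM; [|by apply: pos; rewrite lte_fin expR_gt0|exact: pos].
rewrite lne_EFin ?expR_gt0// expRK muleDr ?fin_num_adde_defr//.
rewrite -EFinM mulrA mulVf ?mul1r ?pnatr_eq0 -?lt0n// addeC.
exact: lexx.
Qed.

Lemma growth_rate_shift (R : realType) (u v : nat -> \bar R) (eta : R) :
  (forall n, 0 <= u n)%E -> (forall n, 0 <= v n)%E ->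
  (forall n, u n <= (expR (n%:R * eta))%:E * v n)%E ->
  (growth_rate u <= growth_rate v + eta%:E)%E.
Proof.
move=> u0 v0 uv; rewrite -leeBlDr//; apply: le_ereal_inf_tmp => _ [W oW <-].
(* The limsup is an infimum, over the sets of the filter, of suprema; intersecting with the positive
   integers stays in the filter and discards [n = 0], where the inverse is 0. *)
rewrite leeBlDr//; apply: (@le_trans _ _ (ereal_sup
    ((fun n => (n%:R^-1)%:E * lne (u n))%E @` (W `&` [set n | (0 < n)%N])))).
  apply: ereal_inf_lbound; exists (W `&` [set n | (0 < n)%N]) => //.
  by apply: filterI => //; exact: nbhs_infty_gt.
apply: ge_ereal_sup => _ [n [Wn n0] <-].
apply: le_trans (lne_rate_le n0 (u0 n) (v0 n) (uv n)) _.
by rewrite leeD2r//; apply: ereal_sup_ubound; exists n.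
Qed.

(** The counting step behind the comparisons of separated sets, spanning sets and covers: each
    finite partial sum over [A] is carried by [g] to a finite partial sum over [B]. *)
Lemma esum_le_inj (R : realType) (S S' : choiceType) (A : set S) (B : set S')
    (g : S -> S') (a : S -> R) (b : S' -> R) (c : R) : 0 <= c ->
  set_inj A g -> (forall x, A x -> B (g x)) -> (forall y, 0 <= b y) ->
  (forall x, A x -> a x <= c * b (g x)) ->
  (\esum_(x in A) (a x)%:E <= c%:E * \esum_(y in B) (b y)%:E)%E.
Proof.
move=> c0 injg gB b0 ab; apply: ge_ereal_sup => _ [Y [finY YA] <-].
apply: (@le_trans _ _ (c%:E * \sum_(y \in g @` Y) (b y)%:E)%E).
  rewrite fsbig_image//; last by apply: sub_in2 injg => x /set_mem /YA /mem_set.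
  rewrite ge0_mule_fsumr//; last by move=> x; rewrite lee_fin.
  by apply: lee_fsum => // x /YA Ax; rewrite -EFinM lee_fin ab.
apply: lee_wpmul2l; first by rewrite lee_fin.
apply: ereal_sup_ubound; exists (g @` Y) => //; split;
  first exact: finite_image.
by move=> _ [x /YA/gB ? <-].
Qed.

Lemma le_mule_ereal_inf (R : realType) (S : set (\bar R)) (a : \bar R) (c : R) :
  0 < c -> (forall y, S y -> a <= c%:E * y)%E -> (a <= c%:E * ereal_inf S)%E.
Proof.
move=> c0 aS; rewrite -lee_pdivrMl//; apply: le_ereal_inf_tmp => y /aS.
by rewrite lee_pdivrMl.
Qed.

Lemma sup_le_nonneg (R : realType) (S : set R) (e : R) : 0 <= e ->
  (forall x, S x -> x <= e) -> sup S <= e.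
Proof.
move=> e0 Se; have [->|/set0P S0] := eqVneq S set0; first by rewrite sup0.
exact: ge_sup.
Qed.

Section covers.
Context (R : realType) (X : pmetricType R) (T : X -> X).
Hypotheses (cX : compact [set: X]) (cT : continuous T).
Implicit Types (C D : set (set X)).

(** A real [sup] dominates its set only if the set is bounded; this bound makes [diameter] and
    [cover_diameter] genuine suprema. *)
Lemma mdist_bounded : exists M : R, forall x y : X, mdist x y <= M.
Proof.
have cd : continuous (mdist (point : X) : X -> R).
  move=> x; apply/cvgrPdist_le => e e0.
  have : nbhs x [set y | mdist x y < e].
    by apply: open_nbhs_nbhs; split; [exact: open_mball|rewrite /= mdistxx].
  apply: filterS => y /= xy; rewrite ler_distlC lerBlDr.
  rewrite (le_trans (metric_triangle _ y _))/=; last first.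
    by rewrite lerD// metric_sym ltW.
  by rewrite (le_trans (metric_triangle _ x _))// lerD// ltW.
have /compact_bounded[M [_ dM]] : compact (mdist (point : X) @` setT : set R).
  by apply: continuous_compact => //; exact: continuous_subspaceT.
have {}dM (y : X) : mdist point y <= M + 1.
  by rewrite (le_trans (ler_norm _))// dM ?ltrDl//; exists y.
exists (M + 1 + (M + 1)) => x y.
by rewrite (le_trans (metric_triangle x point y))// lerD// metric_sym.
Qed.

Lemma cover_diameter_ge C U x y : C U -> U x -> U y ->
  mdist x y <= cover_diameter C.
Proof.
have [M dM] := mdist_bounded.
have M0 : 0 <= M by apply: le_trans (dM point point); exact: mdist_ge0.
have dU (V : set X) : [set mdist x y | x in V & y in V] `<=` [set z | z <= M].
  by move=> _ [a _ [b _ <-]]; exact: dM.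
move=> CU Ux Uy; apply: (@le_trans _ _ (diameter U)).
  apply: ub_le_sup; first by exists M => z /dU.
  by exists x => //; exists y.
apply: ub_le_sup; last by exists U.
by exists M => _ [V _ <-]; apply: sup_le_nonneg => // z /dU.
Qed.

Lemma cover_diameter_le C e : 0 <= e ->
  (forall U x y, C U -> U x -> U y -> mdist x y <= e) -> cover_diameter C <= e.
Proof.
move=> e0 Ce; apply: sup_le_nonneg => // _ [U CU <-].
by apply: sup_le_nonneg => // _ [x Ux [y Uy <-]]; exact: (Ce U).
Qed.

Lemma family_bigjoinP (G : nat -> set (set X)) n A :
  (\big[@family_join R X/[set setT]]_(i < n) G i) A <->
  exists2 f : nat -> set X, (forall i, (i < n)%N -> G i (f i)) &
    A = \bigcap_(i in `I_n) f i.
Proof.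
elim: n G A => [|n IHn] G A.
  rewrite big_ord0; split=> [->|[f _ ->]].
    by exists (fun=> setT) => //; rewrite II0 bigcap_set0.
  by rewrite II0 bigcap_set0.
rewrite big_ord_recl; split=> [[U GU [V + <-]]|[f Gf ->]].
  move=> /(IHn (fun i => G i.+1))[f Gf ->].
  exists (fun i => if i is j.+1 then f j else U) => [[|i]|].
  - by move=> _; exact: GU.
  - exact: Gf.
  apply/seteqP; split => x.
    by move=> [Ux Vx] [|i] //= ni; exact: Vx.
  by move=> Ax; split=> [|i ni]; [exact: (Ax 0)|exact: (Ax i.+1)].
exists (f 0); first exact: Gf.
exists (\bigcap_(i in `I_n) f i.+1).
  by apply/(IHn (fun i => G i.+1)); exists (fun i => f i.+1) => // i ni;
    exact: (Gf i.+1).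
apply/seteqP; split => x.
  by move=> [Ux Vx] [|i] //= ni; exact: Vx.
by move=> Ax; split=> [|i ni]; [exact: (Ax 0)|exact: (Ax i.+1)].
Qed.

Lemma dynamical_joinP C n A : dynamical_join T C n A <->
  exists2 f : nat -> set X, (forall i, (i < n)%N -> C (f i)) &
    A = \bigcap_(i in `I_n) (iter i T @^-1` f i).
Proof.
rewrite /dynamical_join (family_bigjoinP (fun i =>
  [set iter i T @^-1` U | U in C])).
split=> [[f Cf ->]|[f Cf ->]]; last first.
  exists (fun i => iter i T @^-1` f i) => // i /Cf Ci; by exists (f i).
have /choice[g gP] : forall i, exists U, (i < n)%N -> C U /\ iter i T @^-1` U =
  f i.
  move=> i; have [ni|] := boolP (i < n)%N; last by exists setT.
  by have [U CU Uf] := Cf i ni; exists U.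
exists g => [i /gP[]//|]; apply: eq_bigcapr => i /gP[_].
by [].
Qed.

Lemma finite_dynamical_join C n : finite_set C -> finite_set (dynamical_join T
  C n).
Proof.
move=> fC; rewrite /dynamical_join; elim/big_ind : _ => //.
- by move=> D D' fD fD'; exact: finite_image2.
- by move=> i _; exact: finite_image.
Qed.

Lemma continuous_iter i : continuous (iter i T).
Proof.
elim: i => [|i IHi] x; first exact: cvg_id.
by apply: continuous_comp; [exact: IHi|exact: cT].
Qed.

Lemma open_dynamical_join C n : C `<=` open -> dynamical_join T C n `<=` open.
Proof.
move=> oC; rewrite /dynamical_join; elim/big_ind : _ => //.
- by move=> _ ->; exact: openT.
- by move=> D D' oD oD' _ [U /oD oU [V /oD' oV <-]]; exact: openI.
- move=> i _ _ [U /oC oU <-]; apply: open_comp => // x _;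
    exact: continuous_iter.
Qed.

Lemma refines_dynamical_join C D n : refines C D ->
  refines (dynamical_join T C n) (dynamical_join T D n).
Proof.
move=> CD A /dynamical_joinP[f Cf ->].
have /choice[g gP] : forall i, exists V, (i < n)%N -> D V /\ f i `<=` V.
  move=> i; have [ni|] := boolP (i < n)%N; last by exists setT.
  by have [V DV fV] := CD _ (Cf i ni); exists V.
exists (\bigcap_(i in `I_n) (iter i T @^-1` g i)).
  by apply/dynamical_joinP; exists g => // i /gP[].
by move=> x fx i ni; have [_] := gP i ni; apply; exact: fx.
Qed.

(** At every time below [n] the two orbits visit a common member of [C]. *)
Lemma bowen_ball_cover_diameter C n A e x y : cover_diameter C < e ->
  dynamical_join T C n A -> A x -> A y -> bowen_ball T n x e y.
Proof.
move=> Ce /dynamical_joinP[f Cf ->] Ax Ay i ni.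
by apply: le_lt_trans Ce; apply: (cover_diameter_ge (Cf i ni));
  [exact: Ax|exact: Ay].
Qed.

Lemma exists_fine_cover C (e : R) : open_cover C -> 0 < e ->
  exists D, [/\ open_cover D, refines D C & cover_diameter D <= e].
Proof.
move=> [[_ _ CT] oC] e0; have [r r0 rC] := lebesgue_number cX oC CT.
(* Radius at most [r] puts each ball inside a member of [C]; radius at most [e / 2] keeps its
   diameter at most [e]. *)
pose d := Num.min r (e / 2).
have d0 : 0 < d by rewrite lt_min r0 divr_gt0.
pose B (x : X) := [set y | mdist x y < d].
have := cX; rewrite compact_cover => /(_ X setT B) [x _|x _|F _ FT].
- exact: open_mball.
- by exists x => //; rewrite /B /= mdistxx.
exists [set B x | x in [set` F]]; split.
- have oB : [set B x | x in [set` F]] `<=` open.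
    by move=> _ [x _ <-]; exact: open_mball.
  split => //; split.
  + exact: finite_image.
  + by move=> U /oB oU; exact: sub_sigma_algebra.
  + by apply/seteqP; split => // x _; have [y Fy By] := FT x Logic.I;
      exists (B y) => //; exists y.
- move=> _ [x _ <-]; have [U CU xU] := rC x; exists U => // y.
  by rewrite /B/= lt_min => /andP[xy _]; exact: xU.
- apply: cover_diameter_le; first exact: ltW.
  move=> _ x y [z _ <-]; rewrite /B/= !lt_min => /andP[_ zx] /andP[_ zy].
  by rewrite (le_trans (metric_triangle x z y))// (splitr e) lerD ?ltW//
    metric_sym.
Qed.

End covers.

(** * Inequalities between the sums at a fixed time *)

Section pressures.
Context (R : realType) (X : pmetricType R) (T : X -> X) (E : prob_space X -> R).
Hypotheses (cX : compact [set: X]) (cT : continuous T) (cE : continuous E).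
Implicit Types (A : set X) (C D : set (set X)).

Local Notation w := (weight T E).

Lemma bowen_ball_refl n x e : 0 < e -> bowen_ball T n x e x.
Proof. by move=> e0 i _; rewrite mdistxx. Qed.

Lemma bowen_ball_sym n x y e : bowen_ball T n x e y -> bowen_ball T n y e x.
Proof. by move=> xy i /xy; rewrite metric_sym. Qed.

Lemma bowen_ball_trans n x y z e e' : bowen_ball T n x e y ->
  bowen_ball T n y e' z -> bowen_ball T n x (e + e') z.
Proof.
move=> xy yz i ni; apply: le_lt_trans (metric_triangle _ (iter i T y) _) _.
by rewrite ltrD ?xy ?yz.
Qed.

Lemma weight_gt0 n x : 0 < w n x.
Proof. exact: expR_gt0. Qed.

(** For positive [n], [empirical T n] is weak-star continuous because orbit averages of continuous
    functions are continuous. The bound makes [sup_weight] a genuine supremum. *)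
Lemma weight_bounded n : exists M, forall x, w n x <= M.
Proof.
case: n => [|n]; first by exists 1 => x; rewrite /weight mul0r expR0.
have cw : continuous (w n.+1).
  have cemp : continuous (empirical T n.+1).
    move=> x; apply: prob_space_cvg => f cf.
    rewrite Rintegral_empirical//.
    under eq_fun do rewrite Rintegral_empirical//.
    apply: cvgMr; apply: cvg_big => [|i _]; first exact: add_continuous.
    by apply: continuous_comp; [exact: continuous_iter|exact: cf].
  move=> x; apply: continuous_comp; last exact: continuous_expR.
  apply: cvgMr; apply: continuous_comp; [exact: cemp|exact: cE].
have /compact_bounded[M [_ wM]] : compact (w n.+1 @` setT).
  by apply: continuous_compact => //; exact: continuous_subspaceT.
exists (M + 1) => x.
by rewrite (le_trans (ler_norm _))// wM ?ltrDl//; exists x.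
Qed.

Lemma inf_weight_le n A x : A x -> inf_weight T E n A <= w n x.
Proof.
by move=> Ax; apply: ge_inf; [exists 0 => _ [y _ <-];
  exact/ltW/weight_gt0|exists x].
Qed.

Lemma le_sup_weight n A x : A x -> w n x <= sup_weight T E n A.
Proof.
have [M wM] := weight_bounded n => Ax.
by apply: ub_le_sup; [exists M => _ [y _ <-]|exists x].
Qed.

Lemma inf_weight_ge0 n A : 0 <= inf_weight T E n A.
Proof.
have [->|/set0P[x Ax]] := eqVneq A set0;
  first by rewrite /inf_weight image_set0 inf0.
apply: lb_le_inf; first by exists (w n x), x.
by move=> _ [y _ <-]; exact/ltW/weight_gt0.
Qed.

Lemma inf_weight_le_sup n A : inf_weight T E n A <= sup_weight T E n A.
Proof.
have [->|/set0P[x Ax]] := eqVneq A set0.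
  by rewrite /inf_weight /sup_weight !image_set0 inf0 sup0.
exact: le_trans (inf_weight_le n Ax) (le_sup_weight n Ax).
Qed.

Lemma sup_weight_ge0 n A : 0 <= sup_weight T E n A.
Proof. exact: le_trans (inf_weight_ge0 n A) (inf_weight_le_sup n A). Qed.

Lemma Qn_le_Pn n e : 0 < e -> (Qn T E n e <= Pn T E n e)%E.
Proof.
move=> e0; have [F FP totF|A [sA maxA]] := @Zorn_bigcup X (separated_sets T n
  e).
  (* Two points of the union of a chain lie in a common member, so the union is separated. *)
  move=> x y [U FU Ux] [V FV Vy] xy.
  have [UV|VU] := totF _ _ FU FV.
    by apply: (FP V FV) => //; exact: UV.
  by apply: (FP U FU) => //; exact: VU.
apply: (@le_trans _ _ (\esum_(x in A) (w n x)%:E)); last first.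
  by apply: ereal_sup_ubound; exists A.
apply: ereal_inf_lbound; exists A => // x; apply: contrapT => nx.
have far y : A y -> ~ bowen_ball T n x e y by move=> Ay xy; apply: nx; exists y.
have nAx : ~ A x by move=> /far; apply; exact: bowen_ball_refl.
(* A point [x] that no point of [A] shadows could be added to [A], against maximality. *)
apply: (maxA (A `|` [set x])).
  by split=> [y Ay|/(_ x) AxA]; [left|apply: nAx; apply: AxA; right].
move=> y z [Ay|->] [Az|->] yz //; first exact: sA.
  by move=> /bowen_ball_sym; exact: far.
exact: far.
Qed.

Lemma Pn_ge0 n e : (0 <= Pn T E n e)%E.
Proof.
apply: ereal_sup_ubound; exists set0; first by move=> ? ? [].
by rewrite esum_set0.
Qed.

Lemma Qn_ge0 n e : (0 <= Qn T E n e)%E.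
Proof.
by apply: le_ereal_inf_tmp => _ [A _ <-]; apply: esum_ge0 => x _;
  rewrite lee_fin ltW// weight_gt0.
Qed.

Section uniform.
Variables (e0 eta : R).
Hypothesis we : forall n x y, bowen_ball T n x e0 y ->
  w n x <= expR (n%:R * eta) * w n y.

(** Two separated points sent to the same spanning point would shadow each other at scale [e + e];
    hence the doubled scale on the left. *)
Lemma Pn_le_Qn n e : e <= e0 ->
  (Pn T E n (e + e) <= (expR (n%:R * eta))%:E * Qn T E n e)%E.
Proof.
move=> ee0; apply: ge_ereal_sup => _ [A sA <-].
apply: le_mule_ereal_inf; first exact: expR_gt0.
move=> _ [B sB <-]; have /choice[g gP] : forall x, exists y, B y /\ bowen_ball
  T n x e y.
  by move=> x; have [y By xy] := sB x; exists y.
apply: (@esum_le_inj _ _ _ A B g).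
- exact: expR_ge0.
- move=> x y /set_mem Ax /set_mem Ay gxy; apply: contrapT => xy.
  apply: (sA _ _ Ax Ay xy); apply: bowen_ball_trans (gP x).2 _.
  by rewrite gxy; apply: bowen_ball_sym; exact: (gP y).2.
- by move=> x _; exact: (gP x).1.
- by move=> y; exact/ltW/weight_gt0.
- by move=> x _; apply: we; exact: bowen_ball_le (gP x).2.
Qed.

(** Each member of a refining cover lies in the Bowen ball of any of its points, so it contains at
    most one point of a separated set. *)
Lemma pn2_ge_Pn C n e : e <= e0 -> cover_diameter C < e ->
  (Pn T E n e <= (expR (n%:R * eta))%:E * pn2 T E C n)%E.
Proof.
move=> ee0 Ce; apply: ge_ereal_sup => _ [A sA <-].
apply: le_mule_ereal_inf; first exact: expR_gt0.
move=> _ [D [[finD _ DT] DC] <-].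
have /choice[g gP] : forall x, exists V, D V /\ V x.
  move=> x; have [V DV Vx] : (\bigcup_(U in D) U) x by rewrite DT.
  by exists V.
have near V x y : D V -> V x -> V y -> bowen_ball T n x e y.
  move=> /DC[U CU VU] /VU Ux /VU Uy.
  exact: (bowen_ball_cover_diameter cX Ce CU).
rewrite -esum_fset//; last by move=> V _; rewrite lee_fin inf_weight_ge0.
apply: (@esum_le_inj _ _ _ A D g).
- exact: expR_ge0.
- move=> x y /set_mem Ax /set_mem Ay gxy; apply: contrapT => xy.
  apply: (sA _ _ Ax Ay xy); apply: (near (g x));
    [exact: (gP x).1|exact: (gP x).2|].
  by rewrite gxy; exact: (gP y).2.
- by move=> x _; exact: (gP x).1.
- by move=> V; exact: inf_weight_ge0.
(* Every point of [g x] shadows [x] at scale [e0], so the weight of [x] is compared with each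
   candidate for the infimum. *)
move=> x _; rewrite -ler_pdivrMl ?expR_gt0//.
apply: lb_le_inf; first by exists (w n x), x => //; exact: (gP x).2.
move=> _ [y gxy <-]; rewrite ler_pdivrMl ?expR_gt0//; apply: we.
by apply: bowen_ball_le ee0 _ _; apply: (near (g x)) => //;
  [exact: (gP x).1|exact: (gP x).2].
Qed.

Lemma pn3_le_pn4 C n : cover_diameter C < e0 ->
  (pn3 T E C n <= (expR (n%:R * eta))%:E * pn4 T E C n)%E.
Proof.
move=> Ce; apply: le_mule_ereal_inf; first exact: expR_gt0.
move=> _ [D [finD DC DT] <-].
apply: (@le_trans _ _ (\sum_(V \in D) (sup_weight T E n V)%:E)%E).
  by apply: ereal_inf_lbound; exists D.
rewrite -esum_fset//; last by move=> V _; rewrite lee_fin sup_weight_ge0.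
rewrite -esum_fset//; last by move=> V _; rewrite lee_fin inf_weight_ge0.
apply: (@esum_le_inj _ _ _ D D id) => //.
- by move=> V; exact: inf_weight_ge0.
(* An empty member contributes 0 on both sides. *)
move=> V DV; have [->|/set0P[x Vx]] := eqVneq V set0.
  by rewrite /inf_weight /sup_weight !image_set0 inf0 sup0 mulr0.
apply: ge_sup; first by exists (w n x), x.
move=> _ [y Vy <-]; rewrite -ler_pdivrMl ?expR_gt0//.
apply: lb_le_inf; first by exists (w n x), x.
move=> _ [z Vz <-]; rewrite ler_pdivrMl ?expR_gt0//; apply: we.
exact: (bowen_ball_cover_diameter cX Ce (DC _ DV)).
Qed.

End uniform.

Lemma pn4_le_Qn C : open_cover C -> exists2 e, 0 < e &
  forall n, (pn4 T E C n <= Qn T E n e)%E.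
Proof.
move=> [[finC _ CT] oC]; have [r r0 rC] := lebesgue_number cX oC CT.
exists r => // n; apply: le_ereal_inf_tmp => _ [A sA <-].
have /choice[V VP] : forall x, exists V, dynamical_join T C n V /\ bowen_ball T
  n x r `<=` V.
  move=> x; have /choice[f fP] : forall i, exists U, C U /\ [set y | mdist
    (iter i T x) y < r] `<=` U.
    by move=> i; have [U CU rU] := rC (iter i T x); exists U.
  exists (\bigcap_(i in `I_n) (iter i T @^-1` f i)); split.
    by apply/dynamical_joinP; exists f => // i _; exact: (fP i).1.
  by move=> y xy i ni; apply: (fP i).2; exact: xy.
have Vx x : V x x by apply: (VP x).2; exact: bowen_ball_refl.
(* The spanning set [A] may be infinite, but [D] is finite as a part of the finite join. *)
pose D := V @` A.
have DC : D `<=` dynamical_join T C n by move=> _ [x _ <-]; exact: (VP x).1.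
have finD : finite_set D by apply: sub_finite_set DC _;
  exact: finite_dynamical_join.
apply: (@le_trans _ _ (\sum_(U \in D) (inf_weight T E n U)%:E)%E).
  apply: ereal_inf_lbound; exists D => //; split => //.
  apply/seteqP; split => // x _; have [y Ay xy] := sA x.
  exists (V y); first by exists y.
  by apply: (VP y).2; exact: bowen_ball_sym.
rewrite -esum_fset//; last by move=> U _; rewrite lee_fin inf_weight_ge0.
(* Choosing one point of [A] for each member of [D] gives an injection, and the infimum over a
   member is at most the weight of its chosen point, with factor 1. *)
have /choice[g gP] : forall U, exists x, D U -> A x /\ V x = U.
  move=> U; have [[x Ax <-]|nDU] := pselect (D U); last by exists point.
  by exists x.
rewrite -[leRHS]mul1e; apply: (@esum_le_inj _ _ _ D A g) => //.
- by move=> U U' /set_mem/gP[_ gU] /set_mem/gP[_ gU'] gg; rewrite -gU -gU' gg.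
- by move=> U /gP[].
- by move=> x; exact/ltW/weight_gt0.
- by move=> U /gP[_ gU]; rewrite mul1r; apply: inf_weight_le;
    rewrite -[X in X _]gU.
Qed.

Lemma pn2_le_pn1 C n : (pn2 T E C n <= pn1 T E C n)%E.
Proof.
apply: le_ereal_inf_tmp => _ [D DC <-].
apply: (@le_trans _ _ (\sum_(V \in D) (inf_weight T E n V)%:E)%E).
  by apply: ereal_inf_lbound; exists D.
by have [[finD _ _] _] := DC; apply: lee_fsum => // V _;
  rewrite lee_fin inf_weight_le_sup.
Qed.

Lemma finite_subcovers_refining C n : C `<=` open ->
  finite_subcovers T n C `<=` refining_covers T n C.
Proof.
move=> oC D [finD DC DT]; split; last by move=> U /DC CU; exists U.
by split => // U /DC/(open_dynamical_join cT oC) oU; exact: sub_sigma_algebra.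
Qed.

Lemma pn1_le_pn3 C n : C `<=` open -> (pn1 T E C n <= pn3 T E C n)%E.
Proof.
move=> oC; apply: ereal_inf_le_tmp => _ [D DC <-]; exists D => //.
exact: finite_subcovers_refining.
Qed.

Lemma pn2_le_pn4 C n : C `<=` open -> (pn2 T E C n <= pn4 T E C n)%E.
Proof.
move=> oC; apply: ereal_inf_le_tmp => _ [D DC <-]; exists D => //.
exact: finite_subcovers_refining.
Qed.

(** Covers admissible for the finer [D] remain admissible for [C]. Subcovers do not pass from one
    join to another in this way, which sets kind 3 apart in [cover_pressure_le]. *)
Lemma pn1_refines C D n : refines D C -> (pn1 T E C n <= pn1 T E D n)%E.
Proof.
move=> DC; apply: ereal_inf_le_tmp => _ [F [bF FD] <-]; exists F => //;
  split => //.
move=> U /FD[V DV UV]; have [W CW VW] := refines_dynamical_join DC DV.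
by exists W => //; exact: subset_trans VW.
Qed.

Lemma pn_ge0 C n : [/\ 0 <= pn1 T E C n, 0 <= pn2 T E C n,
  0 <= pn3 T E C n & 0 <= pn4 T E C n]%E.
Proof.
split; apply: le_ereal_inf_tmp => _ [D _ <-]; apply: fsume_ge0 => U _;
  by rewrite lee_fin ?sup_weight_ge0 ?inf_weight_ge0.
Qed.

End pressures.

(** * Comparison of the pressures *)

(** One criterion for finite and infinite limits. The lower bound is tested on [b < l], since
    subtracting [eta] from [l = +oo] would demand infinite values of [f]. *)
Lemma ereal_cvg_approx (R : realType) (I : Type) (F : set_system I)
    (f : I -> \bar R) (l : \bar R) : Filter F ->
  (forall eta : R, 0 < eta -> \forall i \near F, (f i <= l + eta%:E)%E) ->
  (forall (b : \bar R) (eta : R), (b < l)%E -> 0 < eta ->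
    \forall i \near F, (b <= f i + eta%:E)%E) ->
  f @ F --> l.
Proof.
move=> FF; case: l => [r| |] fl lf.
- have {}lf (eta : R) : 0 < eta -> \forall i \near F, ((r - eta)%:E <= f i)%E.
    move=> eta0; have e2 : 0 < eta / 2 by rewrite divr_gt0.
    apply: filterS (lf (r - eta / 2)%:E (eta / 2) _ e2) => [i|]; last first.
      by rewrite lte_fin ltrBlDr ltrDl.
    rewrite -leeBlDr// -EFinB; congr (_ <= _)%E; congr EFin; lra.
  apply/fine_cvgP; split.
    apply: filterS2 (fl 1 ltr01) (lf 1 ltr01) => i.
    by case: (f i).
  apply/cvgrPdist_le => e e0; apply: filterS2 (fl e e0) (lf e e0) => i /=.
  case: (f i) => [s| |] //=; rewrite -EFinD !lee_fin => rs sr.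
  by rewrite ler_distlC rs andbT.
- apply/cvgeyPge => A; apply: filterS (lf (A + 1)%:E 1 (ltry _) ltr01) => i.
  by rewrite -leeBlDr// -EFinB addrK.
- apply/cvgeNyPle => A; apply: filterS (fl 1 ltr01) => i.
  by rewrite addNye leeNy_eq => /eqP ->; rewrite leNye.
Qed.

Section main.
Context (R : realType) (X : pmetricType R) (T : X -> X) (E : prob_space X -> R).
Hypotheses (cX : compact [set: X]) (cT : continuous T) (cE : continuous E).
Implicit Types (C D : set (set X)) (e eta : R).

Local Notation P_ e := (growth_rate (Pn T E ^~ e)).
Local Notation Q_ e := (growth_rate (Qn T E ^~ e)).
Local Notation CP := (cover_pressure T E).

Lemma growth_rate_Pn_le e e' : e <= e' -> (P_ e' <= P_ e)%E.
Proof.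
move=> ee'; apply: growth_rate_le => n; first exact: Pn_ge0.
apply: ereal_sup_le => _ [A sA <-]; exists A => // x y Ax Ay xy.
by apply: contra_not (sA _ _ Ax Ay xy); exact: bowen_ball_le.
Qed.

Lemma growth_rate_Qn_le e e' : e <= e' -> (Q_ e' <= Q_ e)%E.
Proof.
move=> ee'; apply: growth_rate_le => n; first exact: Qn_ge0.
apply: ereal_inf_le_tmp => _ [A sA <-]; exists A => // x.
by have [y Ay xy] := sA x; exists y => //; exact: bowen_ball_le xy.
Qed.

(** Monotonicity in the scale turns the limit at 0 into a supremum. *)
Lemma pressureE : pressure T E = ereal_sup [set P_ e | e in [set e | 0 < e]].
Proof.
rewrite (_ : [set e | 0 < e] = [set` `]0, +oo[]); last first.
  by apply/seteqP; split => e /=; rewrite in_itv/= andbT.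
apply: cvg_lim; first exact: ereal_hausdorff.
by apply: nonincreasing_at_right_cvge => // e e' _ _; exact: growth_rate_Pn_le.
Qed.

Lemma spanning_pressureE :
  spanning_pressure T E = ereal_sup [set Q_ e | e in [set e | 0 < e]].
Proof.
rewrite (_ : [set e | 0 < e] = [set` `]0, +oo[]); last first.
  by apply/seteqP; split => e /=; rewrite in_itv/= andbT.
apply: cvg_lim; first exact: ereal_hausdorff.
by apply: nonincreasing_at_right_cvge => // e e' _ _; exact: growth_rate_Qn_le.
Qed.

Lemma le_pressure e : 0 < e -> (P_ e <= pressure T E)%E.
Proof. by move=> e0; rewrite pressureE; apply: ereal_sup_ubound; exists e. Qed.

Lemma spanning_pressure_eq : spanning_pressure T E = pressure T E.
Proof.
apply/eqP; rewrite eq_le; apply/andP; split.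
  rewrite spanning_pressureE; apply: ge_ereal_sup => _ [e e0 <-].
  apply: le_trans (le_pressure e0); apply: growth_rate_le => n.
    exact: Qn_ge0.
  exact: Qn_le_Pn.
apply/lee_addgt0Pr => eta eta0.
have [e0 e00 we] := weight_uniform T cX cE eta0.
rewrite {1}pressureE; apply: ge_ereal_sup => _ [e /= e_gt0 <-].
(* The bound [e0] is for the weights, and [d + d <= e] absorbs the doubling of scale in
   [Pn_le_Qn]. *)
pose d := Num.min e0 (e / 2).
have d0 : 0 < d by rewrite lt_min e00 divr_gt0.
apply: (@le_trans _ _ (P_ (d + d))).
  by apply: growth_rate_Pn_le; rewrite (splitr e) lerD// ge_min lexx orbT.
apply: (@le_trans _ _ (Q_ d + eta%:E)%E).
  apply: growth_rate_shift => n; [exact: Pn_ge0|exact: Qn_ge0|].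
  by apply: (Pn_le_Qn we); rewrite ge_min lexx.
apply: leeD2r; rewrite spanning_pressureE.
by apply: ereal_sup_ubound; exists d.
Qed.

Lemma cover_pressure2_le4 C : open_cover C -> (CP kind2 C <= CP kind4 C)%E.
Proof.
move=> [_ oC]; apply: growth_rate_le => n;
  first by have [] := pn_ge0 cX cT cE C n.
exact: pn2_le_pn4.
Qed.

Lemma cover_pressure1_le3 C : open_cover C -> (CP kind1 C <= CP kind3 C)%E.
Proof.
move=> [_ oC]; apply: growth_rate_le => n;
  first by have [] := pn_ge0 cX cT cE C n.
exact: pn1_le_pn3.
Qed.

Lemma cover_pressure2_le i C : open_cover C -> (CP kind2 C <= CP i C)%E.
Proof.
move=> oC; have le21 : (CP kind2 C <= CP kind1 C)%E.
  apply: growth_rate_le => n; first by have [] := pn_ge0 cX cT cE C n.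
  exact: pn2_le_pn1.
by case: i => //; [exact: le_trans (cover_pressure1_le3 oC)|exact:
  cover_pressure2_le4].
Qed.

Lemma cover_pressure4_le C : open_cover C -> (CP kind4 C <= pressure T E)%E.
Proof.
move=> oC; have [e e0 CQ] := pn4_le_Qn T E cX oC.
apply: (@le_trans _ _ (Q_ e)).
  by apply: growth_rate_le => // n; have [] := pn_ge0 cX cT cE C n.
by rewrite -spanning_pressure_eq spanning_pressureE; apply: ereal_sup_ubound;
  exists e.
Qed.

(** Kind 2 is the smallest of the four, so bounding it serves all kinds, with [e0] depending on
    [eta] only. *)
Lemma cover_pressure_lower eta : 0 < eta -> exists2 e0, 0 < e0 &
  forall e i C, e <= e0 -> open_cover C -> cover_diameter C < e ->
    (P_ e <= CP i C + eta%:E)%E.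
Proof.
move=> eta0; have [e0 e00 we] := weight_uniform T cX cE eta0.
exists e0 => // e i C ee0 oC Ce.
apply: (@le_trans _ _ (CP kind2 C + eta%:E)%E); last first.
  by apply: leeD2r; exact: cover_pressure2_le.
apply: growth_rate_shift => n; first exact: Pn_ge0.
  by have [] := pn_ge0 cX cT cE C n.
exact: (pn2_ge_Pn cX we).
Qed.

Lemma cover_pressure3_le eta : 0 < eta -> exists2 e, 0 < e &
  forall C, open_cover C -> cover_diameter C < e ->
    (CP kind3 C <= pressure T E + eta%:E)%E.
Proof.
move=> eta0; have [e e0 we] := weight_uniform T cX cE eta0.
exists e => // C oC Ce; apply: (@le_trans _ _ (CP kind4 C + eta%:E)%E);
  last first.
  by apply: leeD2r; exact: cover_pressure4_le.
apply: growth_rate_shift => n; try by have [] := pn_ge0 cX cT cE C n.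
exact: (pn3_le_pn4 cX cT cE we).
Qed.

Lemma cover_pressure_le i C : i <> kind3 -> open_cover C ->
  (CP i C <= pressure T E)%E.
Proof.
move=> i3 oC; have le4 := cover_pressure4_le oC.
case: i i3 => // _; last exact: le_trans (cover_pressure2_le4 oC) le4.
apply/lee_addgt0Pr => eta eta0; have [e e0 Pe] := cover_pressure3_le eta0.
have e2 : 0 < e / 2 by rewrite divr_gt0.
(* For kind 1, go up to a finer cover [D] of small diameter, where kind 3 dominates kind 1 and is
   itself controlled. *)
have [D [oD DC De]] := exists_fine_cover cX oC e2.
apply: (@le_trans _ _ (CP kind3 D)).
  apply: le_trans (cover_pressure1_le3 oD); apply: growth_rate_le => n.
    by have [] := pn_ge0 cX cT cE C n.
  exact: pn1_refines.
by apply: Pe => //; rewrite (le_lt_trans De)// ltr_pdivrMr// ltr_pMr// ltr1n.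
Qed.

Lemma cover_pressure_upper eta : 0 < eta -> exists2 e, 0 < e &
  forall i C, open_cover C -> cover_diameter C < e ->
    (CP i C <= pressure T E + eta%:E)%E.
Proof.
move=> eta0; have [e e0 Pe] := cover_pressure3_le eta0;
  exists e => // i C oC Ce.
have [->|i3] := pselect (i = kind3); first exact: Pe.
by rewrite (le_trans (cover_pressure_le i3 oC))// leeDl// lee_fin ltW.
Qed.

Lemma exists_open_cover e : 0 < e -> exists C, open_cover C /\ cover_diameter C
  <= e.
Proof.
move=> e0; have oX : open_cover ([set setT] : set (set X)).
  split; last by move=> _ ->; exact: openT.
  split; [exact: finite_set1| |by rewrite bigcup_set1].
  by move=> _ ->; exact: measurableT.
by have [D [oD _ De]] := exists_fine_cover cX oX e0; exists D.
Qed.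

Lemma pressure_lt b eta : (b < pressure T E)%E -> 0 < eta -> exists2 e, 0 < e &
  forall i C, open_cover C -> cover_diameter C < e -> (b <= CP i C + eta%:E)%E.
Proof.
rewrite pressureE => /ereal_sup_gt[_ [e1 /= e10 <-] be1] eta0.
have [e0 e00 Pe] := cover_pressure_lower eta0.
exists (Num.min e0 e1); first by rewrite lt_min e00.
move=> i C oC Ce; apply: le_trans (Pe _ i C _ oC Ce);
  last by rewrite ge_min lexx.
by apply: le_trans (ltW be1) _; apply: growth_rate_Pn_le;
  rewrite ge_min lexx orbT.
Qed.

End main.

Unset Implicit Arguments.

Theorem theorem4p7 (R : realType) (X : pmetricType R) (T : X -> X)
    (E : prob_space X -> R)
    (compactX : compact [set: X])
    (continuousT : continuous T)
    (surjectiveT : range T = [set: X])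
    (energyE : continuous E) :
  [/\ spanning_pressure T E = pressure T E,
      forall i : cover_kind,
        ereal_sup [set cover_pressure T E i U
                  | U in [set U | open_cover U /\ cover_diameter U <= e]]
          @[e --> 0^'+] --> pressure T E,
      forall (i : cover_kind) (U : nat -> set (set X)),
        (forall k, open_cover (U k)) ->
        cover_diameter (U k) @[k --> \oo] --> (0 : R) ->
        cover_pressure T E i (U k) @[k --> \oo] --> pressure T E &
      forall i : cover_kind, i <> kind3 ->
        ereal_sup [set cover_pressure T E i U | U in open_cover] =
          pressure T E].
Proof.
split.
- exact: spanning_pressure_eq.
- move=> i; apply: ereal_cvg_approx => [eta eta0|b eta bP eta0].
    have [d d0 Pd] := cover_pressure_upper compactX continuousT energyE eta0.
    near=> e; apply: ge_ereal_sup => _ [C [oC Ce] <-]; apply: Pd => //.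
    by apply: le_lt_trans Ce _; near: e; exact: nbhs_right_lt.
  have [d d0 Pd] := pressure_lt compactX continuousT energyE bP eta0.
  near=> e; have e0 : 0 < e by near: e; exact: nbhs_right_gt.
  (* The supremum is bounded below through one member, so a cover of diameter at most [e] must be
     exhibited. *)
  have [C [oC Ce]] := exists_open_cover compactX e0.
  apply: (@le_trans _ _ (cover_pressure T E i C + eta%:E)%E).
    apply: Pd => //; apply: le_lt_trans Ce _.
    by near: e; exact: nbhs_right_lt.
  by apply: leeD2r; apply: ereal_sup_ubound; exists C.
- move=> i U oU U0; have Ud d : 0 < d -> \forall k \near \oo, cover_diameter (U
    k) < d.
    by move=> d0; exact: (cvgr_lt _ U0).
  apply: ereal_cvg_approx => [eta eta0|b eta bP eta0].
    have [d d0 Pd] := cover_pressure_upper compactX continuousT energyE eta0.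
    by apply: filterS (Ud d d0) => k; exact: Pd.
  have [d d0 Pd] := pressure_lt compactX continuousT energyE bP eta0.
  by apply: filterS (Ud d d0) => k; exact: Pd.
- move=> i i3; apply/eqP; rewrite eq_le; apply/andP; split.
    by apply: ge_ereal_sup => _ [C oC <-]; exact: cover_pressure_le.
  apply/lee_addgt0Pr => eta eta0;
  have [d d0 Pd] := cover_pressure_lower compactX continuousT energyE eta0.
  rewrite pressureE; apply: ge_ereal_sup => _ [e /= e0 <-].
  (* Here [r <= d] allows the lower bound and [r <= e] the monotonicity in the scale; diameter at
     most [r / 2] gives the strict inequality. *)
  pose r := Num.min d e; have r0 : 0 < r by rewrite lt_min d0.
  have r2 : 0 < r / 2 by rewrite divr_gt0.
  have [C [oC Cr]] := exists_open_cover compactX r2.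
  apply: (@le_trans _ _ (growth_rate (Pn T E ^~ r))).
    by apply: growth_rate_Pn_le; rewrite ge_min lexx orbT.
  apply: (@le_trans _ _ (cover_pressure T E i C + eta%:E)%E).
    apply: Pd => //; first by rewrite ge_min lexx.
    by rewrite (le_lt_trans Cr)// ltr_pdivrMr// ltr_pMr// ltr1n.
  by apply: leeD2r; apply: ereal_sup_ubound; exists C.
Unshelve. all: by end_near. Qed.
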